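(* Let $k$ be a field, $R=k[x_1,\dots,x_n]$, and let $I\subseteq R$ be the edge ideal of a hypergraph $\mathcal H$ on the vertex set $V=\{1,\dots,n\}$. Then $I^{(2)}=I^2$ if and only if $\mathcal H$ does not contain any special triangle $F_1,F_2,F_3$ such that $(F_1\cup F_2\cup F_3)\cap D$ is indecomposable in $\mathcal H_D$ for $D=V\setminus(F_1\cap F_2\cap F_3)$.
   Context: A hypergraph $\mathcal H$ on $V=\{1,\dots,n\}$ is a set of subsets of $V$ (its edges); containments between edges are allowed. The edge ideal of $\mathcal H$ is the ideal of $R$ generated by all $x^F=\prod_{i\in F}x_i$, $F\in\mathcal H$. $I^{(2)}$ denotes the second symbolic power of $I$, i.e. the intersection of the primary components of $I^2$ belonging to the minimal associated primes of $I^2$. Three edges $F_1,F_2,F_3$ of $\mathcal H$ form a special triangle if there are vertices $v_1\in(F_1\cap F_2)\setminus F_3$, $v_2\in(F_2\cap F_3)\setminus F_1$, $v_3\in(F_1\cap F_3)\setminus F_2$. For $D\subseteq V$, $\mathcal H_D=\{F\cap D\mid F\in\mathcal H\}$, a hypergraph on $D$. A set $U$ is decomposable in a hypergraph if $U$ can be partitioned into two (possibly empty) disjoint subsets each of which contains an edge of the hypergraph; otherwise $U$ is indecomposable. (So every set is decomposable if $\emptyset$ is an edge.) *)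

(* Defs.v *)
From HB Require Import structures.
From mathcomp Require Import all_boot all_order all_algebra.
From mathcomp Require Import mpoly.
From mathcomp Require Import boolp classical_sets.

Set Implicit Arguments.
Unset Strict Implicit.
Unset Printing Implicit Defensive.

Import GRing.Theory.

Local Open Scope ring_scope.
Local Open Scope classical_set_scope.

(** Ideals of a commutative ring are classical sets; the whole ring is an
    ideal. (The [idealr_closed] of [ring_quotient] only covers proper ideals
    with a boolean membership predicate.) *)

Definition ideal (R : comNzRingType) (J : set R) : Prop :=
  [/\ J 0, forall a b, J a -> J b -> J (a + b)
    & forall r a, J a -> J (r * a)].

Definition ideal_gen (R : comNzRingType) (S : set R) : set R :=
  smallest (@ideal R) S.

Definition ideal_mul (R : comNzRingType) (J K : set R) : set R :=
  ideal_gen [set a * b | a in J & b in K].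

Definition ideal_pow (R : comNzRingType) (J : set R) (m : nat) : set R :=
  iter m (ideal_mul J) setT.

Definition radical (R : comNzRingType) (J : set R) : set R :=
  [set a | exists m : nat, J (a ^+ m)].

Definition colon (R : comNzRingType) (J : set R) (f : R) : set R :=
  [set a | J (a * f)].

Definition prime_ideal (R : comNzRingType) (P : set R) : Prop :=
  [/\ ideal P, ~ P 1 & forall a b, P (a * b) -> P a \/ P b].

Definition primary_ideal (R : comNzRingType) (Q : set R) : Prop :=
  [/\ ideal Q, ~ Q 1 & forall a b, Q (a * b) -> Q a \/ radical Q b].

(** Associated primes of [J] are those of the module [R / J]. *)
Definition associated_prime (R : comNzRingType) (J P : set R) : Prop :=
  prime_ideal P /\ exists f : R, P = colon J f.

Definition minimal_associated_prime (R : comNzRingType) (J P : set R) : Prop :=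
  associated_prime J P /\
  forall P' : set R, associated_prime J P' -> P' `<=` P -> P' = P.

(** The decomposition of the unit ideal is the empty one, [r = 0]. *)
Definition minimal_primary_decomposition (R : comNzRingType) (J : set R)
    (r : nat) (Q : 'I_r -> set R) : Prop :=
  [/\ forall i, primary_ideal (Q i),
      J = \bigcap_i Q i,
      forall i j, radical (Q i) = radical (Q j) -> i = j
    & forall i, ~ (\bigcap_(j in [set j | j <> i]) Q j `<=` Q i)].

Definition primary_component (R : comNzRingType) (J P Q : set R) : Prop :=
  radical Q = P /\
  exists (r : nat) (Qs : 'I_r -> set R),
    minimal_primary_decomposition J Qs /\ exists i, Qs i = Q.

(** Components belonging to minimal associated primes do not depend on the
    decomposition, so intersecting over all minimal decompositions is the same
    as fixing one. *)
Definition symbolic_power (R : comNzRingType) (J : set R) (m : nat) : set R :=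
  \bigcap_(Q in [set Q | exists P : set R,
      minimal_associated_prime (ideal_pow J m) P /\
      primary_component (ideal_pow J m) P Q]) Q.

Definition edge_monomial (k : fieldType) (n : nat) (F : {set 'I_n}) :
    {mpoly k[n]} :=
  \prod_(i in F) 'X_i.

Definition edge_ideal (k : fieldType) (n : nat) (H : {set {set 'I_n}}) :
    set {mpoly k[n]} :=
  ideal_gen [set f | exists2 F, F \in H & f = edge_monomial k F].
Arguments edge_ideal k {n} H.

Local Close Scope classical_set_scope.
Local Open Scope set_scope.

Definition special_triangle (n : nat) (H : {set {set 'I_n}})
    (F1 F2 F3 : {set 'I_n}) : Prop :=
  [/\ F1 \in H, F2 \in H & F3 \in H] /\
  [/\ exists v1, v1 \in (F1 :&: F2) :\: F3,
      exists v2, v2 \in (F2 :&: F3) :\: F1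
    & exists v3, v3 \in (F1 :&: F3) :\: F2].

Definition restriction (n : nat) (H : {set {set 'I_n}}) (D : {set 'I_n}) :
    {set {set 'I_n}} :=
  [set F :&: D | F in H].

Definition decomposable (n : nat) (H : {set {set 'I_n}}) (U : {set 'I_n}) :
    Prop :=
  exists A B : {set 'I_n},
    [/\ A :|: B = U, [disjoint A & B],
        exists2 E, E \in H & E \subset A
      & exists2 E, E \in H & E \subset B].

Definition indecomposable (n : nat) (H : {set {set 'I_n}}) (U : {set 'I_n}) :
    Prop :=
  ~ decomposable H U.

(* Main.v *)
Require Import Defs.
From mathcomp Require Import all_boot all_order all_algebra.
From mathcomp Require Import mpoly.
From mathcomp Require Import boolp classical_sets.

Set Implicit Arguments.
Unset Strict Implicit.
Unset Printing Implicit Defensive.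

Import GRing.Theory.

(** All ideals involved are monomial, so membership is a condition on exponent
    vectors [m]. The components of [I^2] at its minimal primes are the
    [P_C^2], where [P_C] is generated by the variables of a minimal vertex cover
    [C]; hence [m] lies in [I^(2)] iff every vertex cover has [m]-weight at
    least 2. The product of the vertices of a special triangle, with the common
    vertices squared, has this property, and it lies in [I^2] only if the union
    of the triangle is decomposable. Conversely, let [m] be in [I^(2)] but not
    in [I^2], and raise exponents from 1 to 2 as long as [m] stays outside
    [I^2]. If the exponent of [s] is still 1, raising it produces two edges
    [E, F] meeting only in [s] and in vertices of exponent 2. The complement of
    the support together with [s] has weight 1, so it is not a cover and some
    edge [G] in the support avoids [s]; then [E, F, G] is the required triangle.

    If no such triangle exists, the [P_C^2] intersect in [I^2] and thus form a
    minimal primary decomposition; no general existence theorem is needed. *)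

(** * Vertex covers and edge pairs in terms of exponent vectors *)

Section VertexCovers.

(* [classical_sets] shadows lemma names of these two files. *)
Import fintype finset.

Definition set_mnm (n : nat) (F : {set 'I_n}) : 'X_{1..n} :=
  [multinom (i \in F : nat) | i < n]%MM.

(** The order of the monomial [m] at the prime [P_C]. *)
Definition set_deg (n : nat) (C : {set 'I_n}) (m : 'X_{1..n}) : nat :=
  (\sum_(i in C) m i)%N.

Definition vertex_cover (n : nat) (H : {set {set 'I_n}}) : pred {set 'I_n} :=
  [pred C : {set 'I_n} | [forall F in H, [exists i in F, i \in C]]].

Definition edge_multiple (n : nat) (H : {set {set 'I_n}}) (m : 'X_{1..n}) :
    bool :=
  [exists F in H, (set_mnm F <= m)%MM].

(** The two edges may coincide, so squares of generators are included. *)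
Definition edge_pair_multiple (n : nat) (H : {set {set 'I_n}})
    (m : 'X_{1..n}) : bool :=
  [exists E in H, exists F in H, (set_mnm E + set_mnm F <= m)%MM].

Lemma set_degD (n : nat) (C : {set 'I_n}) (m1 m2 : 'X_{1..n}) :
  set_deg C (m1 + m2)%MM = (set_deg C m1 + set_deg C m2)%N.
Proof. by rewrite -big_split; apply: eq_bigr => i _; rewrite mnmDE. Qed.

Lemma set_deg1 (n : nat) (C : {set 'I_n}) (c : 'I_n) :
  c \in C -> set_deg C U_(c)%MM = 1%N.
Proof.
move=> cC; rewrite /set_deg (bigD1 c) //= mnm1E eqxx big1 // => i /andP[_ ic].
by rewrite mnm1E eq_sym (negbTE ic).
Qed.

Lemma set_deg_gt0P (n : nat) (C : {set 'I_n}) (m : 'X_{1..n}) :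
  reflect (exists2 c, c \in C & (0 < m c)%N) (0 < set_deg C m)%N.
Proof.
apply: (iffP idP) => [|[c cC mc]].
  rewrite lt0n sum_nat_eq0 negb_forall => /existsP[c].
  by rewrite negb_imply -lt0n => /andP[]; exists c.
by rewrite /set_deg (bigD1 c) //= ltn_addr.
Qed.

Lemma set_deg_mono (n : nat) (C : {set 'I_n}) (m1 m2 : 'X_{1..n}) :
  (m1 <= m2)%MM -> (set_deg C m1 <= set_deg C m2)%N.
Proof. by move=> /mnm_lepP le12; apply: leq_sum => i _; apply: le12. Qed.

Lemma mnm_sub1K (n : nat) (m : 'X_{1..n}) (c : 'I_n) :
  (0 < m c)%N -> (m - U_(c) + U_(c))%MM = m.
Proof.
move=> mc; apply: submK; apply/mnm_lepP => i; rewrite mnm1E.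
by case: eqP => // <-.
Qed.

Lemma vertex_coverP (n : nat) (H : {set {set 'I_n}}) (C : {set 'I_n}) :
  reflect (forall F, F \in H -> exists2 i, i \in F & i \in C)
    (vertex_cover H C).
Proof.
apply: (iffP forall_inP) => HC F /HC.
  by case/exists_inP => i; exists i.
by case=> i iF iC; apply/exists_inP; exists i.
Qed.

Lemma vertex_coverPn (n : nat) (H : {set {set 'I_n}}) (C : {set 'I_n}) :
  ~~ vertex_cover H C -> exists2 F, F \in H & forall i, i \in F -> i \notin C.
Proof.
rewrite negb_forall_in => /exists_inP[F FH]; rewrite negb_exists_in.
by move=> /forall_inP FC; exists F.
Qed.

Lemma set_deg_edge_pair (n : nat) (H : {set {set 'I_n}}) (C : {set 'I_n})
    (m : 'X_{1..n}) :
  vertex_cover H C -> edge_pair_multiple H m -> (1 < set_deg C m)%N.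
Proof.
move=> /vertex_coverP HC /exists_inP[E EH /exists_inP[F FH EFm]].
move: (set_deg_mono C EFm); apply: leq_trans;
rewrite set_degD -[2%N]/(1 + 1)%N; apply: leq_add.
  have [i iE iC] := HC _ EH; apply/set_deg_gt0P.
  by exists i; rewrite // mnmE iE.
have [i iE iC] := HC _ FH; apply/set_deg_gt0P.
by exists i; rewrite // mnmE iE.
Qed.

(** By minimality [C :\ c] misses some edge, and that edge can meet [C] only in [c]. *)
Lemma minimal_cover_private_edge (n : nat) (H : {set {set 'I_n}})
    (C : {set 'I_n}) (c : 'I_n) :
  minset (vertex_cover H) C -> c \in C ->
  exists2 F, F \in H & forall i, i \in F -> i \in C -> i = c.
Proof.
move=> /minsetP[_ minC] cC.
have [/minC CcE|] := boolP (vertex_cover H (C :\ c)).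
  by have := cC; rewrite -CcE ?subsetDl // !inE eqxx.
case/vertex_coverPn => F FH FC; exists F => // i /FC.
by rewrite !inE negb_and negbK => /orP[/eqP|/negP].
Qed.

(** Two variables [c], [d] of [C] are split off from [m] one after the other, so [c = d] is
    possible. The product of their private edges involves no other vertex of [C], and outside [C]
    exponent 2 is always enough. *)
Lemma minimal_cover_edge_pair (n : nat) (H : {set {set 'I_n}})
    (C : {set 'I_n}) (m : 'X_{1..n}) :
  minset (vertex_cover H) C -> (1 < set_deg C m)%N ->
  (forall i, i \notin C -> (1 < m i)%N) -> edge_pair_multiple H m.
Proof.
move=> minC degm mout; have /set_deg_gt0P[c cC mc] := ltnW degm.
have mE := mnm_sub1K mc; set m' := (m - _)%MM in mE.
have /set_deg_gt0P[d dC m'd] : (0 < set_deg C m')%N.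
  by move: degm; rewrite -mE set_degD set_deg1 // addn1.
have [E EH EC] := minimal_cover_private_edge minC cC.
have [F FH FC] := minimal_cover_private_edge minC dC.
apply/exists_inP; exists E => //; apply/exists_inP; exists F => //.
apply/mnm_lepP => i; rewrite mnmDE !mnmE.
have [iC|/mout] := boolP (i \in C); last first.
  by apply: leq_trans; rewrite -[2%N]/(1 + 1)%N leq_add ?leq_b1.
rewrite -mE mnmDE mnm1E addnC; apply: leq_add.
  by case: (boolP (i \in F)) => // /FC-> //.
by case: (boolP (i \in E)) => // /EC->; rewrite ?eqxx.
Qed.

(** * Special triangles and monomials outside the square *)

Lemma bad_monomial_triangle (n : nat) (H : {set {set 'I_n}})
    (m : 'X_{1..n}) :
  (forall C, vertex_cover H C -> (1 < set_deg C m)%N) ->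
  ~~ edge_pair_multiple H m ->
  exists F1 F2 F3 : {set 'I_n},
    let D := (~: (F1 :&: F2 :&: F3))%SET in
    special_triangle H F1 F2 F3 /\
    indecomposable (restriction H D) ((F1 :|: F2 :|: F3) :&: D)%SET.
Proof.
move=> degm npair.
pose W := [set i | (0 < m i)%N]%SET.
(* The vector with exponent 2 on [T] and 1 on the rest of [W] is outside [I^2]: two edges have a
   product dividing it iff both lie in [W] and their intersection lies in [T]. Exponents of [m]
   above 2 count as 2. *)
pose admissible := [pred T : {set 'I_n} | (T \subset W) &&
  [forall E in H, forall F in H,
     (E :|: F \subset W) ==> ~~ (E :&: F \subset T)]].
have adm_dbl : admissible [set i | (1 < m i)%N]%SET.
  apply/andP; split; first by apply/subsetP => i; rewrite !inE => /ltnW.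
  apply/forall_inP => E EH; apply/forall_inP => F FH; apply/implyP.
  rewrite finset.subUset => /andP[/subsetP EW /subsetP FW].
  apply: contra npair => /subsetP EF; apply/exists_inP; exists E => //.
  apply/exists_inP; exists F => //; apply/mnm_lepP => i; rewrite mnmDE !mnmE.
  have := EF i; rewrite !inE.
  case: (boolP (i \in E)) => iE; case: (boolP (i \in F)) => iF //=.
  - exact.
  - by move=> _; have := EW i iE; rewrite inE.
  - by move=> _; have := FW i iF; rewrite inE.
(* [T]: exponent 2, or 1 and raised to 2 along the way. *)
have [T /maxsetP[admT maxT] /subsetP dblT] := maxset_exists adm_dbl.
have {admT} [/subsetP TW /forall_inP admT] := andP admT.
have interT E F : E \in H -> F \in H -> {subset E <= W} -> {subset F <= W} ->
    exists2 i, i \in E :&: F & i \notin T.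
  move=> EH FH EW FW; apply/subsetPn.
  have /forall_inP/(_ F FH)/implyP := admT E EH; apply.
  by rewrite finset.subUset; apply/andP; split; apply/subsetP.
have avoid s : s \notin T -> exists2 F, F \in H &
    {subset F <= W} /\ s \notin F.
  move=> sT; have [|F FH FC] := @vertex_coverPn _ H (s |: ~: W).
    apply/negP => /degm; apply/negP; rewrite -leqNgt.
    rewrite /set_deg (bigD1 s) ?inE ?eqxx //= big1 => [|i].
      by rewrite addn0 leqNgt; apply: contra sT => ms; apply: dblT; rewrite inE.
    by rewrite !inE -leqNgt leqn0 => /andP[/orP[->|/eqP]].
  exists F => //; split => [i /FC|].
    by rewrite !inE negb_or negbK => /andP[].
  by apply/negP => /FC; rewrite !inE eqxx.
(* The complement of the support has weight 0, so some edge [F0] lies in the support. Paired with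
   itself in [interT], it yields a vertex [s] outside [T]. *)
have [|F0 F0H F0C] := @vertex_coverPn _ H (~: W).
  apply/negP => /degm; rewrite /set_deg big1 // => i.
  by rewrite !inE -leqNgt leqn0 => /eqP.
have F0W : {subset F0 <= W} by move=> i /F0C; rewrite inE negbK.
have [s /setIP[sF0 _] sT] := interT _ _ F0H F0H F0W F0W.
have sW := F0W s sF0.
have [E EH [F FH [EW FW EFs]]] : exists2 E, E \in H & exists2 F, F \in H &
    [/\ {subset E <= W}, {subset F <= W} & E :&: F \subset s |: T].
  (* Maximality of [T] makes [s |: T] inadmissible. As [s] is in [W], only the condition on edge
     pairs can fail. *)
  have : ~~ admissible (s |: T).
    apply: contra sT => /maxT <-; first by rewrite in_setU1 eqxx.
    exact: finset.subsetUr.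
  rewrite inE negb_and => /orP[/subsetPn[i]|].
    by rewrite !inE => /orP[/eqP->|/TW]; [move: sW|]; rewrite inE => ->.
  rewrite negb_forall_in => /exists_inP[E EH].
  rewrite negb_forall_in => /exists_inP[F FH]; rewrite negb_imply negbK.
  rewrite finset.subUset => /andP[/andP[/subsetP EW /subsetP FW] EF].
  by exists E => //; exists F.
have [G GH [GW sG]] := avoid s sT.
(* Since [G] avoids [s], all common vertices of the three edges lie in [T]. Hence the vertices
   outside [T] supplied by [interT] lie in exactly two of the edges. *)
have tripleT i : i \in E -> i \in F -> i \in G -> i \in T.
  move=> iE iF iG; have /(subsetP EFs) : i \in E :&: F by rewrite inE iE.
  by rewrite in_setU1 => /orP[/eqP eis|//]; rewrite -eis iG in sG.
exists E, F, G; split.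
  split=> //; split.
  - have [i /setIP[iE iF] iT] := interT _ _ EH FH EW FW.
    by exists i; rewrite !inE iE iF !andbT; apply: contra iT; apply: tripleT.
  - have [i /setIP[iF iG] iT] := interT _ _ FH GH FW GW; exists i.
    by rewrite !inE iF iG !andbT; apply: contra iT => iE; apply: tripleT.
  - have [i /setIP[iE iG] iT] := interT _ _ EH GH EW GW; exists i.
    by rewrite !inE iE iG !andbT; apply: contra iT => iF; apply: tripleT.
(* A decomposition gives edges [E1], [E2] with disjoint traces on [D]. Both lie in [W], so [interT]
   gives a common vertex outside [T]; by [tripleT] it belongs to [D], a contradiction. *)
case=> A [B [ABU AB [_ /imsetP[E1 E1H ->] E1A] [_ /imsetP[E2 E2H ->] E2B]]].
have EFGW (E' X : {set 'I_n}) : E' :&: ~: (E :&: F :&: G) \subset X ->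
    X \subset (E :|: F :|: G) -> {subset E' <= W}.
  move=> /subsetP E'X /subsetP XU i iE'.
  have [|niT] := boolP (i \in E :&: F :&: G).
    by rewrite !inE => /andP[/andP[/EW]]; rewrite inE.
  have /XU : i \in X by apply: E'X; rewrite inE iE' inE niT.
  by rewrite !inE => /orP[/orP[/EW|/FW]|/GW]; rewrite inE.
have AU : A \subset (E :|: F :|: G).
  apply: subset_trans _ (finset.subsetIl _ (~: (E :&: F :&: G))).
  by rewrite -ABU finset.subsetUl.
have BU : B \subset (E :|: F :|: G).
  apply: subset_trans _ (finset.subsetIl _ (~: (E :&: F :&: G))).
  by rewrite -ABU finset.subsetUr.
have [i /setIP[iE1 iE2] iT] :=
  interT _ _ E1H E2H (EFGW _ _ E1A AU) (EFGW _ _ E2B BU).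
have niD : i \in ~: (E :&: F :&: G).
  by rewrite !inE; apply: contra iT => /andP[/andP[]]; apply: tripleT.
have iA : i \in A by apply: (subsetP E1A); rewrite inE iE1.
have iB : i \in B by apply: (subsetP E2B); rewrite inE iE2.
by move/disjoint_setI0: AB => /setP/(_ i); rewrite inE iA iB inE.
Qed.

Lemma triangle_bad_monomial (n : nat) (H : {set {set 'I_n}})
    (F1 F2 F3 : {set 'I_n}) :
  let D := (~: (F1 :&: F2 :&: F3))%SET in
  special_triangle H F1 F2 F3 ->
  indecomposable (restriction H D) ((F1 :|: F2 :|: F3) :&: D)%SET ->
  exists2 m : 'X_{1..n}, ~~ edge_pair_multiple H m &
    forall C, vertex_cover H C -> (1 < set_deg C m)%N.
Proof.
move=> D [[F1H F2H F3H] _] indec.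
pose U := F1 :|: F2 :|: F3.
exists (set_mnm U + set_mnm (~: D))%MM.
  apply/negP => /exists_inP[E EH /exists_inP[F FH /mnm_lepP EF]].
  (* On [D] exponents are at most 1, so there [F] is disjoint from [E] and its trace falls into the
     second part. *)
  apply: indec; exists (E :&: D), (U :&: D :\: E).
  have EFE i : (i \in E) + (i \in F) <= (i \in U) + (i \notin D).
    by have := EF i; rewrite !mnmDE !mnmE finset.in_setC.
  have DU i : i \notin D -> i \in U by rewrite !inE negbK => /andP[/andP[->]].
  have EU i : i \in E -> i \in U.
    move=> iE; have := EFE i; rewrite iE; apply: contraTT => iU.
    rewrite (negbTE iU); have [//|/DU] := boolP (i \in D).
    by rewrite (negbTE iU).
  split.
  - apply/setP => i; rewrite !(inE, finset.in_setC); have := EU i; rewrite !inE.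
    by case: (i \in E) => [/(_ isT) ->|_] /=; rewrite ?andbT ?orbF.
  - rewrite finset.disjoints_subset; apply/subsetP => i.
    by rewrite !inE => /andP[->].
  - exists (E :&: D) => //; apply/imsetP; by exists E.
  - exists (F :&: D); first by apply/imsetP; exists F.
    apply/subsetP => i; rewrite finset.in_setI => /andP[iF iD]; have := EFE i.
    rewrite finset.in_setD finset.in_setI iD iF andbT addn0.
    by case: (i \in E); case: (i \in U).
move=> C /vertex_coverP HC; have [i iF1 iC] := HC _ F1H.
have iU : i \in U by rewrite !inE iF1.
(* A common vertex of the triangle counts twice. Any other [i] is missing from [F2] or [F3], and [C]
   meets that edge in a second vertex [j]. *)
have [iD|iD] := boolP (i \in D); last first.
  have iDC : i \in ~: D by rewrite finset.in_setC.
  rewrite set_degD -[2%N]/(1 + 1)%N; apply: leq_add; apply/set_deg_gt0P;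
    by exists i; rewrite // mnmE ?iU ?iDC.
have [j iNj [jC jU]] : exists2 j, i != j & j \in C /\ j \in U.
  have [[j jF jC] iF2] : (exists2 j, j \in F2 & j \in C) /\
     ((i \notin F2) \/ (i \notin F3)).
    split; first exact: HC.
    by move: iD; rewrite !inE iF1 /=; case: (i \in F2) => /=; auto.
  case: iF2 => [iF2|iF3].
    exists j; first by apply: contraNneq iF2 => ->.
    by rewrite !inE jF orbT.
  have [l lF lC] := HC _ F3H; exists l; first by apply: contraNneq iF3 => ->.
  by rewrite !inE lF orbT.
rewrite set_degD /set_deg (bigD1 i) //= (bigD1 j) /=; last by rewrite jC eq_sym.
by rewrite !mnmE iU jU.
Qed.

End VertexCovers.

(** * Monomial ideals and the square of the edge ideal *)

Section MonomialIdeals.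

Local Open Scope ring_scope.
Local Open Scope classical_set_scope.

Lemma ideal_gen_ideal (R : comNzRingType) (S : set R) : ideal (ideal_gen S).
Proof.
split=> [I [[I0 _ _] _] //|a b Sa Sb I SI|r a Sa I SI]; have [I0 ID IM] := SI.1.
  by apply: ID; [apply: Sa|apply: Sb].
exact: (IM _ _ (Sa I SI)).
Qed.

Lemma mem_ideal_gen (R : comNzRingType) (S : set R) (a : R) :
  S a -> ideal_gen S a.
Proof. by move=> Sa I [_ SI]; apply: SI. Qed.

(** Testing membership on the support gives an ideal once [M] is closed under multiples. *)
Definition monomial_ideal (k : fieldType) (n : nat) (M : pred 'X_{1..n}) :
    set {mpoly k[n]} :=
  [set p | {subset msupp p <= M}].
Arguments monomial_ideal k {n} M.

Lemma monomial_ideal_ideal (k : fieldType) (n : nat) (M : pred 'X_{1..n}) :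
  (forall m1 m2, M m1 -> M (m2 + m1)%MM) -> ideal (monomial_ideal k M).
Proof.
move=> MD; split=> [m|p q Mp Mq m|p q Mq m]; first by rewrite msupp0.
  by move/msuppD_le; rewrite mem_cat => /orP[/Mp|/Mq].
by move/msuppM_le/allpairsP=> [[m1 m2] /= [_ /Mq M2 ->]]; apply: MD.
Qed.

Lemma monomial_ideal_sub (k : fieldType) (n : nat) (M : pred 'X_{1..n})
    (J : set {mpoly k[n]}) :
  ideal J -> (forall m, M m -> J 'X_[m]) -> monomial_ideal k M `<=` J.
Proof.
move=> idJ MJ p Mp; have [J0 JD JM] := idJ.
rewrite [p]mpolyE big_seq; apply: (big_ind J) => // m /Mp /MJ Jm.
by rewrite -mul_mpolyC; apply: JM.
Qed.

Lemma monomial_idealX (k : fieldType) (n : nat) (M : pred 'X_{1..n}) m :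
  monomial_ideal k M 'X_[m] <-> M m.
Proof.
split=> [|Mm m']; first by apply; rewrite msuppX mem_head.
by rewrite msuppX inE => /eqP->.
Qed.

Lemma edge_monomialE (k : fieldType) (n : nat) (F : {set 'I_n}) :
  edge_monomial k F = 'X_[set_mnm F].
Proof.
rewrite mpolyXE_id /edge_monomial big_mkcond; apply: eq_bigr => i _.
by rewrite mnmE; case: ifP.
Qed.

Lemma ideal_monomial_le (k : fieldType) (n : nat) (J : set {mpoly k[n]}) m1 m2 :
  ideal J -> (m1 <= m2)%MM -> J 'X_[m1] -> J 'X_[m2].
Proof. by case=> _ _ JM /submK <- Jm1; rewrite mpolyXD; apply: JM. Qed.

Lemma edge_idealE (k : fieldType) (n : nat) (H : {set {set 'I_n}}) :
  edge_ideal k H = monomial_ideal k (edge_multiple H).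
Proof.
apply/seteqP; split.
  apply: smallest_sub.
    apply: monomial_ideal_ideal => m1 m2 /exists_inP[F FH Fm].
    by apply/exists_inP; exists F => //; apply: lepm_trans Fm (lem_addl _ _).
  move=> _ [F FH ->]; rewrite edge_monomialE; apply/monomial_idealX.
  by apply/exists_inP; exists F => //; apply: lepm_refl.
apply: monomial_ideal_sub; first exact: ideal_gen_ideal.
move=> m /exists_inP[F FH Fm]; apply: ideal_monomial_le Fm _.
  exact: ideal_gen_ideal.
by apply: mem_ideal_gen; exists F; rewrite ?edge_monomialE.
Qed.

Lemma edge_pair_multiple_add (n : nat) (H : {set {set 'I_n}}) m1 m2 :
  edge_pair_multiple H m1 -> edge_pair_multiple H (m2 + m1)%MM.
Proof.
case/exists_inP=> E EH /exists_inP[F FH EFm].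
apply/exists_inP; exists E => //; apply/exists_inP; exists F => //.
exact: lepm_trans EFm (lem_addl _ _).
Qed.

Lemma edge_ideal_squareE (k : fieldType) (n : nat) (H : {set {set 'I_n}}) :
  ideal_pow (edge_ideal k H) 2 = monomial_ideal k (edge_pair_multiple H).
Proof.
have idI : ideal (edge_ideal k H) by apply: ideal_gen_ideal.
have idJ : ideal (monomial_ideal k (edge_pair_multiple H)).
  by apply: monomial_ideal_ideal => m1 m2; apply: edge_pair_multiple_add.
(* [ideal_pow] starts its iteration at the unit ideal, so the innermost factor has to be
   absorbed. *)
have pow1 : ideal_mul (edge_ideal k H) setT = edge_ideal k H.
  apply/seteqP; split.
    apply: smallest_sub => // _ [a Ia [b _ <-]].
    by rewrite mulrC; case: idI => _ _; apply.
  move=> a Ia; apply: mem_ideal_gen; exists a => //.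
  by exists 1; rewrite ?mulr1.
rewrite /ideal_pow /= pow1; apply/seteqP; split.
  apply: smallest_sub => // _ [p Ip [q Iq <-]] m.
  move: Ip Iq; rewrite edge_idealE => Ip Iq.
  move/msuppM_le/allpairsP=> [[m1 m2] /= [/Ip/exists_inP[E EH Em1]]].
  move=> /Iq/exists_inP[F FH Fm2] ->.
  apply/exists_inP; exists E => //; apply/exists_inP; exists F => //.
  apply/mnm_lepP => i; rewrite !mnmDE.
  by apply: leq_add; [move/mnm_lepP: Em1|move/mnm_lepP: Fm2].
apply: monomial_ideal_sub; first exact: ideal_gen_ideal.
move=> m /exists_inP[E EH /exists_inP[F FH EFm]].
apply: ideal_monomial_le EFm _; first exact: ideal_gen_ideal.
rewrite mpolyXD -!edge_monomialE; apply: mem_ideal_gen.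
exists (edge_monomial k E); first by apply: mem_ideal_gen; exists E.
by exists (edge_monomial k F) => //; apply: mem_ideal_gen; exists F.
Qed.

(* The order at [P_C] becomes the order in ['X] over a domain, which is additive
   on products; this makes the powers of [P_C] primary. *)
Definition grading (k : fieldType) (n : nat) (C : {set 'I_n}) :
    {mpoly k[n]} -> {poly {mpoly k[n]}} :=
  mmap (polyC \o @mpolyC n k)
    (fun i => ('X_i)%:P * 'X ^+ (i \in C)).

Lemma gradingM (k : fieldType) (n : nat) (C : {set 'I_n}) :
  {morph @grading k n C : p q / p * q}.
Proof. by move=> p q; rewrite /grading rmorphM. Qed.

(** Each monomial [m] picks up the factor ['X ^+ set_deg C m], so the coefficient of index [j] is
    the part of [p] of weight [j] on [C]. *)
Lemma coef_grading (k : fieldType) (n : nat) (C : {set 'I_n})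
    (p : {mpoly k[n]}) (j : nat) (m : 'X_{1..n}) :
  (grading C p)`_j@_m = p@_m *+ (set_deg C m == j).
Proof.
have mmap1E m' :
    mmap1 (fun i => ('X_i : {mpoly k[n]})%:P * 'X ^+ (i \in C)) m' =
    ('X_[m'])%:P * 'X ^+ set_deg C m'.
  rewrite /mmap1; under eq_bigr => i _ do rewrite exprMn -exprM -rmorphXn /=.
  rewrite big_split /= -rmorph_prod -mpolyXE_id prodrXr.
  congr (_ * 'X ^+ _); rewrite /set_deg [RHS]big_mkcond /=.
  by apply: eq_bigr => i _; case: (i \in C); rewrite ?mul1n ?mul0n.
rewrite {2}[p]mpolyE /grading /mmap coef_sum !raddf_sum -sumrMnl /=.
apply: eq_bigr => m' _; rewrite mmap1E mulrA -polyCM coefCM coefXn.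
rewrite mcoeffZ mcoeffX mul_mpolyC mulr_natr.
have [<-|ne] := eqVneq m' m; last first.
  by rewrite mulr0 mul0rn mcoeffMn mcoeffZ mcoeffX (negbTE ne) mulr0 mul0rn.
by rewrite mulr1 eq_sym mcoeffMn mcoeffZ mcoeffX eqxx mulr1.
Qed.

(** * The powers of [P_C] are primary *)

Definition order_ideal (k : fieldType) (n : nat) (C : {set 'I_n}) (d : nat) :
    set {mpoly k[n]} :=
  monomial_ideal k (fun m => d <= set_deg C m)%N.
Arguments order_ideal k {n} C d.

Lemma order_idealP (k : fieldType) (n : nat) (C : {set 'I_n}) (d : nat)
    (p : {mpoly k[n]}) :
  order_ideal k C d p <-> forall j, (j < d)%N -> (grading C p)`_j = 0.
Proof.
split=> [Cp j jd|Cp m].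
  apply/mpolyP => m; rewrite coef_grading mcoeff0.
  have [/Cp|/memN_msupp_eq0 ->] := boolP (m \in msupp p);
    last by rewrite mul0rn.
  by move/(leq_trans jd); rewrite ltn_neqAle eq_sym => /andP[/negbTE->].
rewrite mcoeff_msupp; apply: contraR; rewrite unfold_in -ltnNge => /Cp.
by move/(congr1 (mcoeff m)); rewrite coef_grading eqxx mcoeff0 mulr1n => ->.
Qed.

Lemma order_ideal_ideal (k : fieldType) (n : nat) (C : {set 'I_n}) (d : nat) :
  ideal (order_ideal k C d).
Proof.
apply: monomial_ideal_ideal => m1 m2 le_d.
by rewrite set_degD (leq_trans le_d) ?leq_addl.
Qed.

(** Once the lower coefficients of [A] vanish, the coefficient of index [j] in the product is
    [A_j * B_0]. *)
Lemma coef_mul_cancel (R : idomainType) (A B : {poly R}) (d : nat) :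
  (forall j, (j < d)%N -> (A * B)`_j = 0) -> B`_0 != 0 ->
  forall j, (j < d)%N -> A`_j = 0.
Proof.
move=> AB0 B0; elim/ltn_ind => j IHj jd.
have := AB0 j jd; rewrite coefM big_ord_recr /= subnn big1 => [|i _].
  by rewrite add0r => /eqP; rewrite mulf_eq0 (negbTE B0) orbF => /eqP.
by rewrite (IHj i (ltn_ord i) (ltn_trans (ltn_ord i) jd)) mul0r.
Qed.

(** Outside [P_C] the grading of [q] has a nonzero constant coefficient. The case [d = 1] makes
    [P_C] prime, and larger [d] makes its powers primary. *)
Lemma order_ideal_cancel (k : fieldType) (n : nat) (C : {set 'I_n}) (d : nat)
    (p q : {mpoly k[n]}) :
  order_ideal k C d (p * q) -> ~ order_ideal k C 1 q -> order_ideal k C d p.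
Proof.
move/order_idealP; rewrite gradingM => Cpq nCq; apply/order_idealP.
apply: coef_mul_cancel Cpq _; apply/eqP => q0; apply: nCq.
by apply/order_idealP => -[].
Qed.

Lemma order_ideal_mul (k : fieldType) (n : nat) (C : {set 'I_n}) (d e : nat)
    (p q : {mpoly k[n]}) :
  order_ideal k C d p -> order_ideal k C e q -> order_ideal k C (d + e) (p * q).
Proof.
move=> Cp Cq m /msuppM_le/allpairsP[[m1 m2] /= [/Cp d1 /Cq e2 ->]].
by rewrite unfold_in set_degD leq_add.
Qed.

(** The successor excludes the zeroth power, which is the whole ring. *)
Lemma order_ideal_not1 (k : fieldType) (n : nat) (C : {set 'I_n}) (d : nat) :
  ~ order_ideal k C d.+1 1.
Proof.
move/(_ 0%MM); rewrite msupp1 mem_head => /(_ isT); rewrite unfold_in.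
by rewrite /set_deg big1 // => i _; rewrite mnm0E.
Qed.

Lemma order_ideal_leq (k : fieldType) (n : nat) (C : {set 'I_n}) (d e : nat) :
  (d <= e)%N -> order_ideal k C e `<=` order_ideal k C d.
Proof. by move=> de p Cp m /Cp; apply: leq_trans. Qed.

Lemma prime_order_ideal1 (k : fieldType) (n : nat) (C : {set 'I_n}) :
  prime_ideal (order_ideal k C 1).
Proof.
split=> [||p q Cpq]; [exact: order_ideal_ideal|exact: order_ideal_not1|].
have [Cq|nCq] := pselect (order_ideal k C 1 q); first by right.
by left; apply: order_ideal_cancel Cpq nCq.
Qed.

Lemma radical_order_ideal (k : fieldType) (n : nat) (C : {set 'I_n}) (d : nat) :
  radical (order_ideal k C d.+1) = order_ideal k C 1.
Proof.
have [_ not1 primeC] := prime_order_ideal1 k C.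
apply/seteqP; split=> [p [j /(order_ideal_leq (ltn0Sn d))]|p Cp].
  by elim: j => [|j IHj]; rewrite ?expr0 // exprS => /primeC[].
exists d.+1; elim: d => // d IHd.
by rewrite exprS -[d.+2]add1n; apply: order_ideal_mul.
Qed.

Lemma primary_order_ideal (k : fieldType) (n : nat) (C : {set 'I_n}) (d : nat) :
  primary_ideal (order_ideal k C d.+1).
Proof.
split=> [||p q Cpq]; [exact: order_ideal_ideal|exact: order_ideal_not1|].
rewrite radical_order_ideal.
have [Cq|nCq] := pselect (order_ideal k C 1 q); first by right.
by left; apply: order_ideal_cancel Cpq nCq.
Qed.

Lemma order_ideal1_var (k : fieldType) (n : nat) (C : {set 'I_n}) (i : 'I_n) :
  order_ideal k C 1 'X_i <-> i \in C.
Proof.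
rewrite /order_ideal; split=> [/monomial_idealX|iC].
  by case/set_deg_gt0P => c cC; rewrite mnm1E; case: eqP => // ->.
by apply/monomial_idealX; rewrite set_deg1.
Qed.

Lemma order_ideal1_sub (k : fieldType) (n : nat) (C : {set 'I_n})
    (P : set {mpoly k[n]}) :
  ideal P -> (forall i, i \in C -> P 'X_i) -> order_ideal k C 1 `<=` P.
Proof.
move=> idP PC; apply: monomial_ideal_sub => // m /set_deg_gt0P[c cC mc].
by have [_ _ PM] := idP; rewrite -(mnm_sub1K mc) mpolyXD; apply/PM/PC.
Qed.

(** * Minimal primes of the square and minimal vertex covers *)

Lemma associated_prime_sub (R : comNzRingType) (J P : set R) :
  ideal J -> associated_prime J P -> J `<=` P.
Proof.
by move=> [_ _ JM] [_ [f ->]] a Ja; rewrite /colon /= mulrC; apply: JM.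
Qed.

Lemma prime_idealX (R : comNzRingType) (P : set R) (a : R) (j : nat) :
  prime_ideal P -> P (a ^+ j) -> P a.
Proof.
case=> _ P1 PM; elim: j => [|j IHj]; rewrite ?expr0 // exprS.
by case/PM.
Qed.

Lemma prime_ideal_prod (R : comNzRingType) (P : set R) (I : eqType) (r : seq I)
    (A : pred I) (F : I -> R) :
  prime_ideal P -> P (\prod_(i <- r | A i) F i) -> exists2 i, A i & P (F i).
Proof.
case=> _ P1 PM; elim: r => [|i r IHr]; first by rewrite big_nil.
rewrite big_cons; case: ifP => // Ai /PM[]; [by exists i|exact: IHr].
Qed.

Definition prime_vars (k : fieldType) (n : nat) (P : set {mpoly k[n]}) :
    {set 'I_n} :=
  [set i | `[< P 'X_i >]]%SET.

(** The prime contains the square of each edge monomial, hence a variable of each edge. *)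
Lemma prime_vars_cover (k : fieldType) (n : nat) (H : {set {set 'I_n}})
    (P : set {mpoly k[n]}) :
  prime_ideal P -> ideal_pow (edge_ideal k H) 2 `<=` P ->
  vertex_cover H (prime_vars P).
Proof.
move=> primeP IP; apply/vertex_coverP => F FH.
have : P (edge_monomial k F ^+ 2).
  apply: IP; rewrite edge_ideal_squareE edge_monomialE expr2 -mpolyXD.
  apply/monomial_idealX; apply/exists_inP; exists F => //.
  by apply/exists_inP; exists F => //; apply: lepm_refl.
move/(prime_idealX primeP)/(prime_ideal_prod primeP) => [i iF Pi].
by exists i; rewrite // inE; apply/asboolP.
Qed.

(** This monomial lies outside [P_C], so it is a unit in the localization there. For a minimal cover
    [C], multiplying by it moves all of [P_C^2] into [I^2]. *)
Definition outside_square (n : nat) (C : {set 'I_n}) : 'X_{1..n} :=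
  [multinom (i \notin C).*2 | i < n]%MM.

Lemma set_deg_outside_square (n : nat) (C : {set 'I_n}) :
  set_deg C (outside_square C) = 0%N.
Proof. by rewrite /set_deg big1 // => i iC; rewrite mnmE iC. Qed.

Lemma outside_square_edge_pair (n : nat) (H : {set {set 'I_n}})
    (C : {set 'I_n}) (m : 'X_{1..n}) :
  minset (vertex_cover H) C -> (1 < set_deg C m)%N ->
  edge_pair_multiple H (m + outside_square C)%MM.
Proof.
move=> minC degm; apply: (minimal_cover_edge_pair minC).
  by rewrite set_degD set_deg_outside_square addn0.
by move=> i iC; rewrite mnmDE mnmE iC addn2.
Qed.

Lemma minimal_cover_associated (k : fieldType) (n : nat) (H : {set {set 'I_n}})
    (C : {set 'I_n}) :
  minset (vertex_cover H) C ->
  associated_prime (ideal_pow (edge_ideal k H) 2) (order_ideal k C 1).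
Proof.
move=> minC; have Ccover := minsetp minC.
split; first exact: prime_order_ideal1.
(* [e] is a variable of [C], or 1 if [C] is empty. Then [f] has weight at most 1, so a multiplier of
   weight 0 cannot bring it into [I^2], while for nonempty [C] any multiplier of positive weight
   does. *)
have [e Ce0 Ce1] : exists2 e : 'X_{1..n}, (set_deg C e <= 1)%N &
    forall c, c \in C -> set_deg C e = 1%N.
  have [->|[c cC]] := set_0Vmem C.
    by exists 0%MM => [|c]; rewrite ?inE // /set_deg big_set0.
  by exists U_(c)%MM => [|_ _]; rewrite set_deg1.
pose f := (e + outside_square C)%MM.
have deg_f : set_deg C f = set_deg C e.
  by rewrite set_degD set_deg_outside_square addn0.
exists 'X_[f]; rewrite edge_ideal_squareE; apply/seteqP; split=> p.
  move=> Cp m; rewrite (perm_mem (msuppMX p f)) => /mapP[m' /Cp Cm' ->].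
  have /set_deg_gt0P[c cC _] := Cm'.
  rewrite unfold_in [(f + _)%MM]addmC addmA.
  apply: outside_square_edge_pair => //.
  by rewrite set_degD (Ce1 c cC) addn1.
move=> Jpf m pm.
have /Jpf/(set_deg_edge_pair Ccover) : (f + m)%MM \in msupp (p * 'X_[f]).
  by rewrite (perm_mem (msuppMX p f)) map_f.
rewrite set_degD deg_f unfold_in lt0n; apply: contraTneq => ->.
by rewrite addn0 -leqNgt.
Qed.

(** The variables in a smaller associated prime form a cover inside [C], hence all of [C]. *)
Lemma minimal_cover_minimal_associated (k : fieldType) (n : nat)
    (H : {set {set 'I_n}}) (C : {set 'I_n}) :
  minset (vertex_cover H) C ->
  minimal_associated_prime (ideal_pow (edge_ideal k H) 2) (order_ideal k C 1).
Proof.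
move=> minC; split; first exact: minimal_cover_associated.
move=> P assP PC; have [primeP _] := assP.
have Pcover : vertex_cover H (prime_vars P).
  by apply: (prime_vars_cover primeP); apply: associated_prime_sub assP;
    apply: ideal_gen_ideal.
apply/seteqP; split=> //; apply: order_ideal1_sub; first by case: primeP.
move=> i; rewrite -(minsetinf minC Pcover); first by rewrite inE => /asboolP.
by apply/fintype.subsetP => j; rewrite inE => /asboolP/PC/order_ideal1_var.
Qed.

(** The variables in [P] contain a minimal cover [C]; then [P_C] is an associated prime inside [P],
    and minimality of [P] gives equality. *)
Lemma minimal_associated_cover (k : fieldType) (n : nat)
    (H : {set {set 'I_n}}) (P : set {mpoly k[n]}) :
  minimal_associated_prime (ideal_pow (edge_ideal k H) 2) P ->
  exists2 C, minset (vertex_cover H) C & P = order_ideal k C 1.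
Proof.
case=> assP minP; have [primeP _] := assP.
have Pcover : vertex_cover H (prime_vars P).
  by apply: (prime_vars_cover primeP); apply: associated_prime_sub assP;
    apply: ideal_gen_ideal.
have [C minC /fintype.subsetP CP] := minset_exists Pcover; exists C => //.
apply/esym/minP; first exact: minimal_cover_associated.
apply: order_ideal1_sub; first by case: primeP.
by move=> i /CP; rewrite inE => /asboolP.
Qed.

(** * The second symbolic power *)

Lemma symbolic_power_sub (R : comNzRingType) (J : set R) (d : nat) :
  ideal_pow J d `<=` symbolic_power J d.
Proof.
move=> a Ja Q [P [_ [_ [r [Qs [[_ JQ _ _] [i <-]]]]]]].
by move: Ja; rewrite JQ; apply.
Qed.

(** For a component [Q] with radical [P_C], the product with [outside_square C] lies in [I^2] and so
    in [Q]. The second factor is outside the radical, so the first lies in [Q]. *)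
Lemma symbolic_square_monomial (k : fieldType) (n : nat)
    (H : {set {set 'I_n}}) (m : 'X_{1..n}) :
  (forall C, vertex_cover H C -> (1 < set_deg C m)%N) ->
  symbolic_power (edge_ideal k H) 2 'X_[m].
Proof.
move=> degm Q [P [/minimal_associated_cover[C minC ->]]].
case=> radQ [r [Qs [[primQs JQ _ _] [i Qi]]]].
have [_ _ primQ] := primQs i; rewrite Qi radQ in primQ.
have [|//|] := primQ 'X_[m] 'X_[outside_square C].
  have : ideal_pow (edge_ideal k H) 2 ('X_[m] * 'X_[outside_square C]).
    rewrite edge_ideal_squareE -mpolyXD; apply/monomial_idealX.
    by apply: outside_square_edge_pair => //; apply/degm/minsetp.
  by rewrite JQ => /(_ i I); rewrite Qi.
by rewrite /order_ideal => /monomial_idealX; rewrite set_deg_outside_square.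
Qed.

(** If no minimal primary decomposition existed, [symbolic_power] would be an empty intersection,
    hence the whole ring. One is therefore exhibited. *)
Lemma symbolic_square_eq (k : fieldType) (n : nat) (H : {set {set 'I_n}}) :
  (forall m, (forall C, vertex_cover H C -> (1 < set_deg C m)%N) ->
    edge_pair_multiple H m) ->
  symbolic_power (edge_ideal k H) 2 = ideal_pow (edge_ideal k H) 2.
Proof.
move=> pairH; apply/seteqP; split; last exact: symbolic_power_sub.
pose covers := [set C | minset (vertex_cover H) C]%SET.
(* If the empty set is an edge there are no covers: the family is empty and its intersection is the
   unit ideal. *)
pose Qs (i : 'I_#|covers|) := order_ideal k (enum_val i) 2.
have minQ i : minset (vertex_cover H) (enum_val (A := covers) i).
  by have := enum_valP i; rewrite inE.
have QsE : ideal_pow (edge_ideal k H) 2 = \bigcap_i Qs i.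
  rewrite edge_ideal_squareE; apply/seteqP; split=> p Jp.
    by move=> i _ m /Jp; apply: set_deg_edge_pair; apply: minsetp (minQ i).
  move=> m mp; apply: pairH => C0 /minset_exists[C minC /fintype.subsetP CC0].
  have Cin : C \in covers by rewrite inE.
  have := Jp (enum_rank_in Cin C) I m mp; rewrite enum_rankK_in //.
  move/leq_trans; apply.
  rewrite /set_deg [leqRHS]big_mkcond [leqLHS]big_mkcond /=.
  by apply: leq_sum => i _; case: ifP => [/CC0->|].
have decQ : minimal_primary_decomposition (ideal_pow (edge_ideal k H) 2) Qs.
  split=> // [i|i j|i].
  - exact: primary_order_ideal.
  - rewrite !radical_order_ideal => eqC; apply: enum_val_inj; apply/setP => c.
    apply/idP/idP => /(@order_ideal1_var k); [rewrite eqC|rewrite -eqC];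
      by move/order_ideal1_var.
  (* Irredundancy: this monomial has weight 0 on its own cover, but weight at least 2 on every other
     minimal cover, which must contain a vertex outside the given one. *)
  - move/(_ 'X_[outside_square (enum_val i)])=> Qi.
    have /monomial_idealX : Qs i 'X_[outside_square (enum_val i)].
      apply: Qi => j ji; apply/monomial_idealX.
      have [/(minsetinf (minQ i) (minsetp (minQ j)))/enum_val_inj//|] :=
        boolP (enum_val j \subset enum_val i).
      case/subsetPn=> c cj ci.
      by rewrite /set_deg (bigD1 c) //= mnmE ci.
    by rewrite set_deg_outside_square.
move=> p Sp; rewrite QsE => i _; apply: Sp.
exists (order_ideal k (enum_val i) 1); split.
  exact: minimal_cover_minimal_associated.
split; first by rewrite radical_order_ideal.
by exists #|covers|, Qs; split=> //; exists i.
Qed.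

End MonomialIdeals.

Theorem theorem3p5 (k : fieldType) (n : nat) (H : {set {set 'I_n}}) :
  symbolic_power (edge_ideal k H) 2 = ideal_pow (edge_ideal k H) 2 <->
  ~ exists F1 F2 F3 : {set 'I_n},
      let D := (~: (F1 :&: F2 :&: F3))%SET in
      special_triangle H F1 F2 F3 /\
      indecomposable (restriction H D) ((F1 :|: F2 :|: F3) :&: D)%SET.
Proof.
split=> [symE [F1 [F2 [F3 [tri indec]]]]|notri].
  have [m /negP npair degm] := triangle_bad_monomial tri indec; apply: npair.
  have := @symbolic_square_monomial k n H m degm.
  by rewrite symE edge_ideal_squareE => /monomial_idealX.
apply: symbolic_square_eq => m degm; apply: contrapT => /negP npair.
exact/notri/(bad_monomial_triangle degm npair).
Qed.
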